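(* Let $G$ be a (small) category with finitely many objects and let $R=A\rtimes^{\sigma}G$ be a skew category algebra, graded by $G$, whose principal component $A$ is commutative. If $A$ has the ideal intersection property in $R$, then $A$ is maximal commutative in $R$, i.e. $C_R(A)=A$.
   Context: All rings are associative and unital with nonzero identity; ring homomorphisms preserve identities. For a subset $S$ of a ring $R$, $C_R(S)$ is the set of elements of $R$ commuting with every element of $S$. A subring $R'$ of $R$ has the ideal intersection property in $R$ if $R'\cap I\neq\{0\}$ for each nonzero two-sided ideal $I$ of $R$. A commutative subring $R'$ is maximal commutative in $R$ if $R'=C_R(R')$. Write $s\in G$ for a morphism $s$ of $G$, with domain $d(s)$ and codomain $c(s)$. Objects are identified with their identity morphisms. $G^{(2)}$ is the set of pairs $(s,t)$ of morphisms with $d(s)=c(t)$ (so that $st$ is defined). Skew category algebra: one is given rings $A_e$, $e\in \mathrm{ob}(G)$, with $A=\bigoplus_{e\in \mathrm{ob}(G)}A_e$, and ring homomorphisms $\sigma_s:A_{d(s)}\to A_{c(s)}$, $s\in G$, such that $\sigma_e=\mathrm{id}_{A_e}$ for all $e\in\mathrm{ob}(G)$ and $\sigma_s\sigma_t=\sigma_{st}$ for all $(s,t)\in G^{(2)}$. $A\rtimes^{\sigma}G$ is the set of formal sums $\sum_{s\in G}a_su_s$ with $a_s\in A_{c(s)}$, all but finitely many zero, with componentwise addition and with multiplication the bilinear extension of $(a_su_s)(b_tu_t)=a_s\sigma_s(b_t)u_{st}$ if $(s,t)\in G^{(2)}$, and $(a_su_s)(b_tu_t)=0$ otherwise, where $a_s\in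 A_{c(s)}$, $b_t\in A_{c(t)}$. It is graded by $G$ with $R_s=A_{c(s)}u_s$, and when $G$ has finitely many objects its identity is $\sum_{e\in\mathrm{ob}(G)}u_e$. Its principal component $\bigoplus_{e\in\mathrm{ob}(G)}A_eu_e$ is identified with $A$. *)

(* Defs.v *)
From HB Require Import structures.
From mathcomp Require Import all_boot all_algebra finmap classical_sets.
From mathcomp Require Import monalg.

Set Implicit Arguments.
Unset Strict Implicit.
Unset Printing Implicit Defensive.

Import GRing.Theory.

Local Open Scope ring_scope.
Local Open Scope classical_set_scope.

Section RingNotions.
Variable R : pzRingType.
Implicit Types S I : set R.

Definition commutant S : set R := [set x | forall y, S y -> x * y = y * x].

Definition commutative_subset S : Prop := forall x y, S x -> S y -> x * y = y * x.

(* Arbitrary (Prop-valued) ideals; the whole ring is allowed. *)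
Definition two_sided_ideal I : Prop :=
  [/\ I 0,
      forall x y, I x -> I y -> I (x - y)
    & forall r x, I x -> I (r * x) /\ I (x * r)].

Definition ideal_intersection_property S : Prop :=
  forall I, two_sided_ideal I -> I <> [set 0] -> S `&` I <> [set 0].

Definition is_subring S : Prop :=
  [/\ S 1,
      forall x y, S x -> S y -> S (x - y)
    & forall x y, S x -> S y -> S (x * y)].

End RingNotions.

(* [cat_hom e f] is the set of morphisms with domain [e] and codomain [f], so that
   the pairs (s, t) with d(s) = c(t) are exactly those [cat_comp] accepts. *)
Record fin_ob_category := FinObCategory {
  cat_ob : finType;
  cat_hom : cat_ob -> cat_ob -> choiceType;
  cat_id : forall e, cat_hom e e;
  cat_comp : forall e f g, cat_hom f g -> cat_hom e f -> cat_hom e g;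
  comp_idl : forall e f (s : cat_hom e f), cat_comp (cat_id f) s = s;
  comp_idr : forall e f (s : cat_hom e f), cat_comp s (cat_id e) = s;
  compA : forall e f g h (s : cat_hom g h) (t : cat_hom f g) (u : cat_hom e f),
    cat_comp s (cat_comp t u) = cat_comp (cat_comp s t) u }.

Arguments cat_id {_} e.
Arguments cat_comp {_ e f g} s t.

Record skew_system (G : fin_ob_category) := SkewSystem {
  coefring : cat_ob G -> nzRingType;
  act : forall e f, cat_hom e f -> {rmorphism coefring e -> coefring f};
  act_id : forall e (a : coefring e), act (cat_id e) a = a;
  act_comp : forall e f g (s : cat_hom f g) (t : cat_hom e f) (a : coefring e),
    act s (act t a) = act (cat_comp s t) a }.

Arguments act {G} _ {e f} s.

Section MalgLift.
Variables (K : choiceType) (V W : zmodType).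

(* The extension of [<< v *g k >> |-> h k v] to finitely supported functions;
   it is additive when each [h k] is. *)
Definition malg_lift (h : K -> V -> W) (x : {malg V[K]}) : W :=
  \sum_(k <- msupp x) h k x@_k.

Variable h : K -> {additive V -> W}.

Lemma malg_liftw (d : {fset K}) (x : {malg V[K]}) :
  (msupp x `<=` d)%fset -> malg_lift h x = \sum_(k <- d) h k x@_k.
Proof.
move=> le; rewrite /malg_lift (big_fset_incl _ le) // => k _ kx.
by rewrite mcoeff_outdom ?raddf0.
Qed.

Lemma malg_lift_is_additive : {morph malg_lift h : x y / x - y}.
Proof.
move=> x y; set d := (msupp x `|` msupp y)%fset.
rewrite (@malg_liftw d) ?msuppB_le // (@malg_liftw d x) ?fsubsetUl //.
rewrite (@malg_liftw d y) ?fsubsetUr // -sumrB.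
by apply: eq_bigr => k _; rewrite mcoeffB raddfB.
Qed.

Lemma malg_liftU k v : malg_lift h << v *g k >> = h k v.
Proof.
by rewrite (malg_liftw (msuppU_le (k := k))) big_seq_fset1 mcoeffUU.
Qed.

Lemma malg_additive_ext (f g : {malg V[K]} -> W) :
    {morph f : x y / x - y} -> {morph g : x y / x - y} ->
  (forall k v, f << v *g k >> = g << v *g k >>) -> f =1 g.
Proof.
move=> fB gB fg x.
pose fa := GRing.isZmodMorphism.Build _ _ f fB.
pose ga := GRing.isZmodMorphism.Build _ _ g gB.
pose F : {additive _ -> _} := HB.pack f fa.
pose F' : {additive _ -> _} := HB.pack g ga.
rewrite -[f x]/(F x) -[g x]/(F' x) (monalgE x) !raddf_sum.
by apply: eq_bigr => k _; apply: fg.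
Qed.

End MalgLift.

Section SkewCategoryAlgebra.
Variables (G : fin_ob_category) (D : skew_system G).
Local Notation A := (coefring D).

(* The formal sum [\sum_s a_s u_s], with [a_s] in [A (c s)], is stored as the
   family, indexed by pairs (e, f) of objects, of the finitely supported
   functions [s |-> a_s] on [cat_hom e f].  As there are finitely many objects, this
   is finiteness of the support over all morphisms. *)
Definition skew_alg : Type :=
  {dffun forall p : cat_ob G * cat_ob G, {malg A p.2[cat_hom p.1 p.2]}}.

HB.instance Definition _ := Choice.on skew_alg.

Definition block (x : skew_alg) (e f : cat_ob G) : {malg A f[cat_hom e f]} := x (e, f).

Definition skew_of (F : forall e f : cat_ob G, {malg A f[cat_hom e f]}) : skew_alg :=
  [ffun p => F p.1 p.2].

Definition skew_coef (x : skew_alg) (e f : cat_ob G) (s : cat_hom e f) : A f :=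
  (block x e f)@_s.

Lemma blockE F e f : block (skew_of F) e f = F e f.
Proof. by rewrite /block ffunE. Qed.

Lemma blockP x y : (forall e f, block x e f = block y e f) -> x = y.
Proof. by move=> xy; apply/ffunP => -[e f]; apply: xy. Qed.

Definition skew_zero := skew_of (fun e f => 0).
Definition skew_opp x := skew_of (fun e f => - block x e f).
Definition skew_add x y := skew_of (fun e f => block x e f + block y e f).

Lemma skew_addA : associative skew_add.
Proof. by move=> x y z; apply: blockP => e f; rewrite !blockE addrA. Qed.
Lemma skew_addC : commutative skew_add.
Proof. by move=> x y; apply: blockP => e f; rewrite !blockE addrC. Qed.
Lemma skew_add0 : left_id skew_zero skew_add.
Proof. by move=> x; apply: blockP => e f; rewrite !blockE add0r. Qed.
Lemma skew_addN : left_inverse skew_zero skew_opp skew_add.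
Proof. by move=> x; apply: blockP => e f; rewrite !blockE addNr. Qed.

HB.instance Definition _ := GRing.isZmodule.Build skew_alg
  skew_addA skew_addC skew_add0 skew_addN.

(* The bilinear extension of [(a u_s)(b u_t) = a sigma_s(b) u_{st}] for [s] in
   [cat_hom f g] and [t] in [cat_hom e f]. *)
Definition conv e f g (x : {malg A g[cat_hom f g]}) (y : {malg A f[cat_hom e f]}) :
    {malg A g[cat_hom e g]} :=
  \sum_(s <- msupp x) \sum_(t <- msupp y)
    << x@_s * act D s y@_t *g cat_comp s t >>.

(* Only composable pairs contribute: the middle object [f] is shared. *)
Definition skew_mul (x y : skew_alg) : skew_alg :=
  skew_of (fun e g => \sum_(f : cat_ob G) conv (block x f g) (block y e f)).

Definition skew_mon e f (s : cat_hom e f) (a : A f) : skew_alg :=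
  finfun (@dfwith _ (fun p : cat_ob G * cat_ob G => {malg A p.2[cat_hom p.1 p.2]})
            (fun=> 0) (e, f) << a *g s >>).

Definition skew_one : skew_alg := \sum_(e : cat_ob G) skew_mon (cat_id e) 1.

Lemma block_mon e f (s : cat_hom e f) a : block (skew_mon s a) e f = << a *g s >>.
Proof. by rewrite /block ffunE dfwith_in. Qed.

Lemma block_mon_out e f (s : cat_hom e f) a e' f' :
  (e, f) != (e', f') -> block (skew_mon s a) e' f' = 0.
Proof. by move=> ne; rewrite /block ffunE dfwith_out. Qed.

Lemma block_is_additive e f : {morph (fun x => block x e f) : x y / x - y}.
Proof. by move=> x y; rewrite !blockE. Qed.

Definition block_at e f (x : skew_alg) := block x e f.

HB.instance Definition _ e f := GRing.isZmodMorphism.Build _ _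
  (block_at e f) (@block_is_additive e f).

Lemma block_sum (I : Type) (r : seq I) (P : pred I) (F : I -> skew_alg) e f :
  block (\sum_(i <- r | P i) F i) e f = \sum_(i <- r | P i) block (F i) e f.
Proof. exact: (raddf_sum (block_at e f)). Qed.

Lemma block1 e : block skew_one e e = << 1 *g cat_id e >>.
Proof.
rewrite block_sum (bigD1 e) //= block_mon big1 ?addr0 // => i ne.
by rewrite block_mon_out // xpair_eqE negb_and ne.
Qed.

Lemma block1_out e f : e != f -> block skew_one e f = 0.
Proof.
move=> ne; rewrite block_sum big1 // => i _.
rewrite block_mon_out // xpair_eqE negb_and; case: eqVneq => //= ->.
by rewrite ne.
Qed.

Section Conv.
Variables e f g : cat_ob G.
Implicit Types (x : {malg A g[cat_hom f g]}) (y : {malg A f[cat_hom e f]}).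

Definition conv_term (s : cat_hom f g) (a : A g) (t : cat_hom e f) (b : A f) :
  {malg A g[cat_hom e g]} := << a * act D s b *g cat_comp s t >>.

Lemma conv_term_is_additive s a t : {morph conv_term s a t : x y / x - y}.
Proof. by move=> b c; rewrite /conv_term raddfB mulrBr monalgUB. Qed.

HB.instance Definition _ s a t := GRing.isZmodMorphism.Build _ _
  (conv_term s a t) (@conv_term_is_additive s a t).

Lemma convBr x : {morph conv (e := e) x : y z / y - z}.
Proof.
move=> y z; rewrite /conv -sumrB; apply: eq_bigr => s _.
exact: (malg_lift_is_additive (fun t => conv_term s x@_s t)).
Qed.

Definition conv_lterm y (s : cat_hom f g) (a : A g) := malg_lift (conv_term s a) y.

Lemma conv_lterm_is_additive y s : {morph conv_lterm y s : a b / a - b}.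
Proof.
move=> a b; rewrite /conv_lterm /malg_lift -sumrB; apply: eq_bigr => t _.
by rewrite /conv_term mulrBl monalgUB.
Qed.

HB.instance Definition _ y s := GRing.isZmodMorphism.Build _ _
  (conv_lterm y s) (@conv_lterm_is_additive y s).

Lemma convBl y : {morph (fun x : {malg A g[cat_hom f g]} => conv x y) : x z / x - z}.
Proof. exact: (malg_lift_is_additive (fun s => conv_lterm y s)). Qed.

Lemma convUU (s : cat_hom f g) (a : A g) (t : cat_hom e f) (b : A f) :
  conv << a *g s >> << b *g t >> = << a * act D s b *g cat_comp s t >>.
Proof.
have -> : conv << a *g s >> << b *g t >> = conv_lterm << b *g t >> s a.
  exact: (malg_liftU (fun s => conv_lterm << b *g t >> s)).
exact: (malg_liftU (fun t => conv_term s a t)).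
Qed.

HB.instance Definition _ x := GRing.isZmodMorphism.Build _ _
  (conv (e := e) x) (@convBr x).
Definition convl y (x : {malg A g[cat_hom f g]}) := conv x y.
HB.instance Definition _ y := GRing.isZmodMorphism.Build _ _
  (convl y) (@convBl y).

Lemma convr0 x : conv x (0 : {malg A f[cat_hom e f]}) = 0.
Proof. exact: (raddf0 (conv (e := e) x)). Qed.
Lemma conv0r y : conv (0 : {malg A g[cat_hom f g]}) y = 0.
Proof. exact: (raddf0 (convl y)). Qed.
Lemma convDr x : {morph conv (e := e) x : y z / y + z}.
Proof. exact: (raddfD (conv (e := e) x)). Qed.
Lemma convDl y : {morph (fun x : {malg A g[cat_hom f g]} => conv x y) : x z / x + z}.
Proof. exact: (raddfD (convl y)). Qed.
Lemma conv_sumr x (I : Type) (r : seq I) (P : pred I)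
    (F : I -> {malg A f[cat_hom e f]}) :
  conv x (\sum_(i <- r | P i) F i) = \sum_(i <- r | P i) conv x (F i).
Proof. exact: (raddf_sum (conv (e := e) x)). Qed.
Lemma conv_suml y (I : Type) (r : seq I) (P : pred I)
    (F : I -> {malg A g[cat_hom f g]}) :
  conv (\sum_(i <- r | P i) F i) y = \sum_(i <- r | P i) conv (F i) y.
Proof. exact: (raddf_sum (convl y)). Qed.

End Conv.

Lemma convA e f g h (x : {malg A h[cat_hom g h]}) (y : {malg A g[cat_hom f g]})
    (z : {malg A f[cat_hom e f]}) : conv x (conv y z) = conv (conv x y) z.
Proof.
move: x; apply: malg_additive_ext => [x x'|x x'|s a].
- exact: convBl.
- by rewrite !convBl.
move: y; apply: malg_additive_ext => [y y'|y y'|t b].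
- by rewrite convBl convBr.
- by rewrite convBr convBl.
move: z; apply: malg_additive_ext => [z z'|z z'|u c].
- by rewrite !convBr.
- exact: convBr.
by rewrite !convUU compA rmorphM act_comp mulrA.
Qed.

Lemma conv1r e f (x : {malg A f[cat_hom e f]}) : conv << 1 *g cat_id f >> x = x.
Proof.
move: x; apply: malg_additive_ext => [x y|//|s a]; first exact: convBr.
by rewrite convUU comp_idl act_id mul1r.
Qed.

Lemma convr1 e f (x : {malg A f[cat_hom e f]}) : conv x << 1 *g cat_id e >> = x.
Proof.
move: x; apply: malg_additive_ext => [x y|//|s a]; first exact: convBl.
by rewrite convUU comp_idr rmorph1 mulr1.
Qed.

Lemma skew_mulA : associative skew_mul.
Proof.
move=> x y z; apply: blockP => e h; rewrite !blockE.
under eq_bigr do rewrite blockE conv_sumr.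
under [RHS]eq_bigr do rewrite blockE conv_suml.
rewrite exchange_big; apply: eq_bigr => f _; apply: eq_bigr => g _.
exact: convA.
Qed.

Lemma skew_mul1 : left_id skew_one skew_mul.
Proof.
move=> x; apply: blockP => e f; rewrite blockE (bigD1 f) //= block1 conv1r.
by rewrite big1 ?addr0 // => i ne; rewrite block1_out // conv0r.
Qed.

Lemma skew_mulr1 : right_id skew_one skew_mul.
Proof.
move=> x; apply: blockP => e f; rewrite blockE (bigD1 e) //= block1 convr1.
by rewrite big1 ?addr0 // => i ne; rewrite block1_out ?convr0 // eq_sym.
Qed.

Lemma skew_mulDl : left_distributive skew_mul +%R.
Proof.
move=> x y z; apply: blockP => e f; rewrite !blockE -big_split.
by apply: eq_bigr => i _; rewrite !blockE convDl.
Qed.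

Lemma skew_mulDr : right_distributive skew_mul +%R.
Proof.
move=> x y z; apply: blockP => e f; rewrite !blockE -big_split.
by apply: eq_bigr => i _; rewrite !blockE convDr.
Qed.

HB.instance Definition _ := GRing.Zmodule_isPzRing.Build skew_alg
  skew_mulA skew_mul1 skew_mulr1 skew_mulDl skew_mulDr.

Lemma skew_mon_mul e f g (s : cat_hom f g) (t : cat_hom e f) a b :
  skew_mon s a * skew_mon t b = skew_mon (cat_comp s t) (a * act D s b).
Proof.
apply: blockP => e' g'; rewrite blockE.
have [[<- <-]|ne] := eqVneq (e, g) (e', g').
  rewrite (bigD1 f) //= !block_mon convUU big1 ?addr0 // => i ne.
  by rewrite block_mon_out ?conv0r // xpair_eqE negb_and eq_sym ne.
rewrite (block_mon_out _ _ ne) big1 // => i _; move: ne.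
rewrite xpair_eqE negb_and => /orP[] ne.
  by rewrite [X in conv _ X]block_mon_out ?convr0 // xpair_eqE negb_and ne.
by rewrite block_mon_out ?conv0r // xpair_eqE negb_and ne orbT.
Qed.

Lemma skew_mon_mul0 e f f' g (s : cat_hom f' g) (t : cat_hom e f) a b :
  f' != f -> skew_mon s a * skew_mon t b = 0.
Proof.
move=> ne; apply: blockP => e' g'; rewrite blockE /block ffunE big1 // => i _.
have [fi|nfi] := eqVneq f' i.
  rewrite -[X in conv _ X]/(block _ _ _) [X in conv _ X]block_mon_out ?convr0 //.
  by rewrite xpair_eqE negb_and -fi (eq_sym f) ne orbT.
by rewrite -/(block _ _ _) block_mon_out ?conv0r // xpair_eqE negb_and nfi.
Qed.

Lemma skew_algE (x : skew_alg) :
  x = \sum_(e : cat_ob G) \sum_(f : cat_ob G) \sum_(s <- msupp (block x e f))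
        skew_mon s (skew_coef x s).
Proof.
apply: blockP => e f; rewrite block_sum (bigD1 e) //= [X in _ + X]big1 ?addr0.
  rewrite block_sum (bigD1 f) //= [X in _ + X]big1 ?addr0.
    rewrite block_sum [LHS]monalgE; apply: eq_bigr => s _.
    by rewrite block_mon.
  move=> f' ne; rewrite block_sum big1 // => s _.
  by rewrite block_mon_out // xpair_eqE negb_and ne orbT.
move=> e' ne; rewrite block_sum big1 // => f' _; rewrite block_sum big1 // => s _.
by rewrite block_mon_out // xpair_eqE negb_and ne.
Qed.

(* With no object at all, the algebra is the zero ring. *)
Lemma skew_alg_oner_neq0 (e : cat_ob G) : 1 != 0 :> skew_alg.
Proof.
apply/eqP => /(congr1 (fun x => skew_coef x (cat_id e))).
rewrite /skew_coef -[1]/skew_one block1 mcoeffUU blockE mcoeff0.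
by apply/eqP/oner_neq0.
Qed.

Definition principal_elt (a : forall e : cat_ob G, A e) : skew_alg :=
  \sum_(e : cat_ob G) skew_mon (cat_id e) (a e).

(* The principal component, i.e. the copy of [\bigoplus_e A_e] in the algebra. *)
Definition principal_component : set skew_alg := range principal_elt.

Lemma principal_component_subring : is_subring principal_component.
Proof.
have pB a b : principal_elt a - principal_elt b
    = principal_elt (fun e => a e - b e).
  rewrite /principal_elt -sumrB; apply: eq_bigr => e _.
  apply: blockP => e' f'; rewrite block_is_additive.
  have [[<- <-]|ne] := eqVneq (e, e) (e', f'); first by rewrite !block_mon monalgUB.
  by rewrite !block_mon_out // subrr.
have pM a b : principal_elt a * principal_elt b
    = principal_elt (fun e => a e * b e).
  rewrite /principal_elt big_distrl; apply: eq_bigr => e _.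
  rewrite big_distrr (bigD1 e) //= skew_mon_mul comp_idl act_id.
  by rewrite big1 ?addr0 // => f ne; rewrite skew_mon_mul0 // eq_sym.
split; first by exists (fun=> 1).
  by move=> _ _ [a _ <-] [b _ <-]; rewrite pB; eexists.
by move=> _ _ [a _ <-] [b _ <-]; rewrite pM; eexists.
Qed.

End SkewCategoryAlgebra.

Arguments principal_component {G} D _.

(* Main.v *)
(* Let x commute with A.  Commutation with the u_e puts x on the diagonal, and
   commutation with A_e gives a (sigma_s b - b) = 0 for every term a u_s of x and
   every b in A_e.  Summing coefficients over parallel morphisms defines an additive
   map aug whose kernel is a left ideal and which is injective on A, so
   I = {y | aug (y t) = 0 for all t} is a two-sided ideal with A `&` I = 0.
   The relation on a says exactly that a u_s - a u_e lies in I; hence it is 0 and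
   a = 0 unless s = e. *)
From HB Require Import structures.
From mathcomp Require Import all_boot all_algebra finmap classical_sets.
From mathcomp Require Import monalg.
Require Import Defs.

Set Implicit Arguments.
Unset Strict Implicit.
Unset Printing Implicit Defensive.

Import GRing.Theory.

Local Open Scope ring_scope.
Local Open Scope classical_set_scope.

Section AugmentationIdeal.
Variables (G : fin_ob_category) (D : skew_system G).
Local Notation A := (coefring D).
Implicit Types x y : skew_alg D.

Lemma block_mul x y e g :
  block (x * y) e g = \sum_(f : cat_ob G) conv (block x f g) (block y e f).
Proof. exact: blockE. Qed.

Definition aug (K : choiceType) (V : zmodType) : {malg V[K]} -> V :=
  malg_lift (fun=> idfun).

Lemma aug_is_additive (K : choiceType) (V : zmodType) :
  {morph @aug K V : x y / x - y}.
Proof. exact: (malg_lift_is_additive (fun=> idfun : {additive V -> V})). Qed.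

HB.instance Definition _ (K : choiceType) (V : zmodType) :=
  GRing.isZmodMorphism.Build _ _ (@aug K V) (@aug_is_additive K V).

Lemma augU (K : choiceType) (V : zmodType) (k : K) (v : V) : aug << v *g k >> = v.
Proof. exact: (malg_liftU (fun=> idfun : {additive V -> V})). Qed.

(** The right side sees [y] only through [aug y], so the kernel of [aug] is stable under left
    multiplication. *)
Lemma aug_conv e f g (x : {malg A g[cat_hom f g]}) (y : {malg A f[cat_hom e f]}) :
  aug (conv x y) = \sum_(s <- msupp x) x@_s * act D s (aug y).
Proof.
move: y; apply: malg_additive_ext => [y z|y z|t b].
- by rewrite convBr raddfB.
- rewrite -sumrB; apply: eq_bigr => s _.
  by rewrite !raddfB mulrBr.
rewrite augU [X in conv X](monalgE x) conv_suml raddf_sum.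
by apply: eq_bigr => s _; rewrite convUU /= augU.
Qed.

(** Ranging over all right multiples [x * t] builds in stability on the right, which the kernel of
    [aug] alone need not have. *)
Definition aug_ideal : set (skew_alg D) :=
  [set x | forall t e f, aug (block (x * t) e f) = 0].

Lemma aug_ideal_two_sided : two_sided_ideal aug_ideal.
Proof.
split=> [t e f|x y Ix Iy t e f|r x Ix].
- by rewrite mul0r blockE raddf0.
- by rewrite mulrBl block_is_additive raddfB /= Ix Iy subrr.
split=> t e f; last by rewrite -mulrA.
rewrite -mulrA block_mul raddf_sum big1 // => g _.
by rewrite /= aug_conv Ix big1 // => s _; rewrite raddf0 mulr0.
Qed.

Lemma block_principal (a : forall e, A e) e :
  block (principal_elt a) e e = << a e *g cat_id e >>.
Proof.
rewrite block_sum (bigD1 e) //= block_mon big1 ?addr0 // => i ne.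
by rewrite block_mon_out // xpair_eqE negb_and ne.
Qed.

Lemma block_principal_out (a : forall e, A e) e f :
  e != f -> block (principal_elt a) e f = 0.
Proof.
move=> ne; rewrite block_sum big1 // => i _.
rewrite block_mon_out // xpair_eqE negb_and; case: eqVneq => //= ->.
by rewrite ne.
Qed.

Lemma aug_ideal_principal : principal_component D `&` aug_ideal = [set 0].
Proof.
apply/seteqP; split=> [_ [[a _ <-] Ia]|_ ->]; last first.
  split; last by case: aug_ideal_two_sided.
  have [S1 SB _] := principal_component_subring D.
  by rewrite -(subrr 1); apply: SB.
apply: blockP => e f; rewrite [RHS]blockE.
have [<-|/block_principal_out-> //] := eqVneq e f.
(* With [t = 1], [aug] returns the only coefficient of the diagonal block. *)
have := Ia 1 e e; rewrite mulr1 block_principal augU => ->.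
exact: monalgU0.
Qed.

Lemma skew_mon_principal e (a : A e) : principal_component D (skew_mon (cat_id e) a).
Proof.
exists (@dfwith _ (fun i => A i : Type) (fun=> 0) e a) => //.
rewrite /principal_elt (bigD1 e) //= dfwith_in big1 ?addr0 // => i ne.
rewrite dfwith_out 1?eq_sym //; apply: blockP => f g; rewrite [RHS]blockE.
have [[<- <-]|neq] := eqVneq (i, i) (f, g); last exact: block_mon_out.
by rewrite block_mon monalgU0.
Qed.

Lemma coefring_comm : commutative_subset (principal_component D) ->
  forall e (a b : A e), a * b = b * a.
Proof.
move=> commA e a b.
have := commA _ _ (skew_mon_principal a) (skew_mon_principal b).
rewrite !skew_mon_mul !act_id comp_idl => /(congr1 (fun x => block x e e)).
(* Here [aug] merely strips the identity morphism from both monomials. *)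
by rewrite !block_mon => /(congr1 (@aug _ _)); rewrite !augU.
Qed.

(** Multiplying by [b] on the right twists it by [act D s], on the left it does not; the comparison
    of the two sides drives the proof. *)
Lemma skew_coef_mulr_id x e f (s : cat_hom e f) (b : A e) :
  skew_coef (x * skew_mon (cat_id e) b) s = skew_coef x s * act D s b.
Proof.
rewrite /skew_coef block_mul (bigD1 e) //= block_mon big1 => [|i ne]; last first.
  by rewrite [X in conv _ X]block_mon_out ?convr0 // xpair_eqE eqxx /= eq_sym.
rewrite addr0; move: (block x e f).
apply: malg_additive_ext => [y z|y z|t a].
- by rewrite convBl mcoeffB.
- by rewrite mcoeffB mulrBl.
rewrite convUU comp_idr !mcoeffU.
by case: eqVneq => [->|]; rewrite ?mulr1n // !mulr0n mul0r.
Qed.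

Lemma skew_coef_mull_id x e f (s : cat_hom e f) (b : A f) :
  skew_coef (skew_mon (cat_id f) b * x) s = b * skew_coef x s.
Proof.
rewrite /skew_coef block_mul (bigD1 f) //= block_mon big1 => [|i ne]; last first.
  by rewrite [X in conv X _]block_mon_out ?conv0r // xpair_eqE eqxx andbT eq_sym.
rewrite addr0; move: (block x e f).
apply: malg_additive_ext => [y z|y z|t a].
- by rewrite convBr mcoeffB.
- by rewrite mcoeffB mulrBr.
rewrite convUU comp_idl act_id !mcoeffU.
by case: eqVneq => [_|]; rewrite ?mulr1n // !mulr0n mulr0.
Qed.

(** At [s : e -> f], the element [x u_e] has the coefficient of [x], while [u_e x] only has terms
    with codomain [e]. *)
Lemma commutant_block_out x e f :
  commutant (principal_component D) x -> e != f -> block x e f = 0.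
Proof.
move=> Cx ne; apply/malgP => s; rewrite mcoeff0 -[LHS]/(skew_coef x s).
rewrite -[LHS]mulr1 -(rmorph1 (act D s)) -skew_coef_mulr_id.
rewrite (Cx _ (skew_mon_principal 1)) /skew_coef block_mul big1 ?mcoeff0 // => i _.
by rewrite block_mon_out ?conv0r // xpair_eqE negb_and ne orbT.
Qed.

(** Since [s] is an endomorphism, right multiplication by [b u_t] gives
    [a sigma_s(b) u_{st} - a b u_t]: two parallel terms whose coefficients cancel in the sum. *)
Lemma skew_mon_sub_aug_ideal e (s : cat_hom e e) (a : A e) :
  (forall b, a * act D s b = a * b) ->
  aug_ideal (skew_mon s a - skew_mon (cat_id e) a).
Proof.
move=> sa t f g; rewrite block_mul raddf_sum big1 // => i _.
rewrite block_is_additive.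
have [[<- <-]|ne] := eqVneq (e, e) (i, g); last first.
  by rewrite !block_mon_out // subrr conv0r raddf0.
rewrite !block_mon; move: (block t f e).
apply: malg_additive_ext => [y z|y z|u b].
- by rewrite convBr raddfB.
- by rewrite subrr.
by rewrite convBl !convUU raddfB /= !augU act_id sa subrr.
Qed.

Lemma commutant_coef_eq0 x e (s : cat_hom e e) :
  commutative_subset (principal_component D) ->
  ideal_intersection_property (principal_component D) ->
  commutant (principal_component D) x -> s != cat_id e -> skew_coef x s = 0.
Proof.
move=> commA iip Cx ns; set a := skew_coef x s.
apply/eqP/negPn/negP => /eqP a0.
have sa b : a * act D s b = a * b.
  (* Commutation of [x] with [b u_e], read at [s], gives [a sigma_s(b) = b a]. *)
  rewrite [RHS](coefring_comm commA) -skew_coef_mulr_id.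
  by rewrite (Cx _ (skew_mon_principal b)) skew_coef_mull_id.
(* A trivial intersection forces the ideal itself to be zero. *)
apply: (iip _ aug_ideal_two_sided _ aug_ideal_principal) => I0.
have := skew_mon_sub_aug_ideal sa; rewrite I0 => /(congr1 (fun y => skew_coef y s)).
(* As [s] is not the identity, the coefficient of the difference at [s] is [a]. *)
rewrite /skew_coef block_is_additive !block_mon mcoeffB !mcoeffU eqxx mulr1n.
by rewrite eq_sym (negPf ns) mulr0n subr0 [in RHS]blockE mcoeff0.
Qed.

End AugmentationIdeal.

Theorem theorem4 (G : fin_ob_category) (D : skew_system G)
    (commA : commutative_subset (principal_component D)) :
  ideal_intersection_property (principal_component D) ->
  commutant (principal_component D) = principal_component D.
Proof.
move=> iip; apply/seteqP; split=> [x Cx|x Ax y Ay]; last exact: commA.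
(* The identity coefficients of [x] determine it, all others being zero. *)
exists (fun e => skew_coef x (cat_id e)) => //.
apply: blockP => e f; have [<-|ne] := eqVneq e f; last first.
  by rewrite block_principal_out // (commutant_block_out Cx).
rewrite block_principal; apply/malgP => s; rewrite mcoeffU.
have [<-|ns] := eqVneq (cat_id e) s; first by rewrite mulr1n.
by rewrite mulr0n -[RHS]/(skew_coef x s) (commutant_coef_eq0 commA) // eq_sym.
Qed.
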